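(* Let $0<q<1$ and $\nu>-1$. Let $f\in L_q^1(\mathbf{R}^+)$ be such that both $f$ and its $q$-Hankel transform $H_q^\nu f$ vanish at the points $q^{-n}$, $n=0,1,2,\dots$. Then $$f(q^k)=0,\qquad k=0,\pm1,\pm2,\dots,$$ that is, $f$ is zero as an element of $L_q^1(\mathbf{R}^+)$.
   Context: Notation: $(a;q)_0=1$, $(a;q)_n=\prod_{k=1}^n(1-aq^{k-1})$, $(a;q)_\infty=\lim_{n\to\infty}(a;q)_n$. Jackson's $q$-integral on $(0,\infty)$ is $\int_0^\infty f(t)\,d_qt=(1-q)\sum_{n=-\infty}^{\infty}f(q^n)q^n$. The space $L_q^1(\mathbf{R}^+)$ consists of functions $f$ with $\int_0^\infty|f(t)|\,d_qt<\infty$, two functions being identified when they agree on the grid $\{q^n\}_{n\in\mathbf{Z}}$. The third Jackson $q$-Bessel function is $$J_\nu^{(3)}(x;q)=\frac{(q^{\nu+1};q)_\infty}{(q;q)_\infty}\sum_{n=0}^\infty(-1)^n\frac{q^{n(n+1)/2}}{(q^{\nu+1};q)_n(q;q)_n}x^{2n+\nu},$$ and $J_\nu^{(3)}(x;q^2)$ is obtained by replacing $q$ by $q^2$ throughout. The $q$-Hankel transform is $$(H_q^\nu f)(x)=\int_0^\infty (xt)^{1/2}J_\nu^{(3)}(xt;q^2)f(t)\,d_qt,$$ where the $q$-integral is understood to converge absolutely at the points $x$ where the transform is evaluated. *)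

(* Defs.v *)
From Stdlib Require Import Reals ZArith Arith.
From Coquelicot Require Import Coquelicot.
Open Scope R_scope.

(** Stdlib reals with Coquelicot. *)

Fixpoint qpoch (a q : R) (n : nat) : R :=
  match n with
  | O => 1
  | S m => qpoch a q m * (1 - a * q ^ m)
  end.

(** Coquelicot's [Lim_seq] and [Series] are total; for [0 < q < 1] the limit
    below exists, as does the sum of the series in [qBessel] when [-1 < nu]
    and [0 < x]. *)
Definition qpoch_inf (a q : R) : R := real (Lim_seq (fun n => qpoch a q n)).

(** Third Jackson q-Bessel function with base [q], for [0 < x].  The division
    in the exponent [n * (n + 1) / 2] is exact. *)
Definition qBessel (nu x q : R) : R :=
  qpoch_inf (Rpower q (nu + 1)) q / qpoch_inf q q *
  Series (fun n : nat =>
    (-1) ^ n * (q ^ (n * (n + 1) / 2)%nat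
                / (qpoch (Rpower q (nu + 1)) q n * qpoch q q n))
    * Rpower x (2 * INR n + nu)).

(** Sums over all integers, split as [n >= 0] and [n <= -1]. *)
Definition ex_zseries (u : Z -> R) : Prop :=
  ex_series (fun n : nat => u (Z.of_nat n)) /\
  ex_series (fun n : nat => u (- Z.of_nat (S n))%Z).

Definition zSeries (u : Z -> R) : R :=
  Series (fun n : nat => u (Z.of_nat n)) +
  Series (fun n : nat => u (- Z.of_nat (S n))%Z).

(** Functions on the positive half-line are represented by [f : R -> C], of
    which only the values on the grid [q^n], [n : Z], are ever used.
    [Lq1 q f] says that the nonnegative series defining the q-integral of
    [|f|] converges; applied to an integrand, it is absolute convergence of
    the q-integral. *)
Definition Lq1 (q : R) (f : R -> C) : Prop :=
  ex_zseries (fun n : Z => Cmod (f (powerRZ q n)) * powerRZ q n).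

Definition qintR (q : R) (g : R -> R) : R :=
  (1 - q) * zSeries (fun n : Z => g (powerRZ q n) * powerRZ q n).

(** The q-integral of a complex function, by real and imaginary parts; it is
    the sum of the defining series whenever [Lq1 q f]. *)
Definition qint (q : R) (f : R -> C) : C :=
  (qintR q (fun t => Re (f t)), qintR q (fun t => Im (f t))).

Definition qHankel_integrand (q nu : R) (f : R -> C) (x t : R) : C :=
  (RtoC (sqrt (x * t) * qBessel nu (x * t) (q ^ 2)) * f t)%C.

Definition qHankel (q nu : R) (f : R -> C) (x : R) : C :=
  qint q (qHankel_integrand q nu f x).

(* Main.v *)
(** Put [p = q^2] and write the transform at [x = q^-m] as [x^(nu + 1/2)] times
    [F(x^2)], where [F(z)] is the sum of [c_n mu_n z^n], the [c_n] are the
    coefficients of the Bessel series and [mu_n] is the sum over [k] of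
    [a_k p^(k n)], with [a_k] a positive multiple of [f(q^k)].
    Since only [k >= 1] occurs, [mu_n = O(p^n)], so the coefficients of [F] are
    [O(p^(n(n+3)/2))], while [F] vanishes at all [p^-m].  The function with
    exactly these zeros, the infinite product of the [1 - z p^m], has coefficients of
    size [p^(n(n-1)/2)], so [F] is too small unless it is zero.  Concretely,
    removing the zeros one at a time preserves [F 0] and multiplies the
    [p^(n(n+3)/2)]-weighted coefficient bound by about [p^2]; hence [F 0 = 0], and
    the same applies to [F(z) / z], and so on.  Thus all moments [mu_n] vanish,
    and letting [n] tend to infinity kills the [a_k] one by one. *)

Require Import Defs.
From Stdlib Require Import Reals ZArith Arith Lra Lia.
From Coquelicot Require Import Coquelicot.
Open Scope R_scope.

(** * Domination and exchange of sums for real series *)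

Lemma ex_series_dom (a b : nat -> R) :
  (forall n, Rabs (a n) <= b n) -> ex_series b -> ex_series a.
Proof. exact (ex_series_le a b). Qed.

Lemma ex_series_mult_const (c : R) (a : nat -> R) :
  ex_series a -> ex_series (fun n => c * a n).
Proof. exact (ex_series_scal_l c a). Qed.

Lemma Series_dom (a b : nat -> R) :
  (forall n, Rabs (a n) <= b n) -> ex_series b -> Rabs (Series a) <= Series b.
Proof.
  intros Hab Hb.
  apply Rle_trans with (Series (fun n => Rabs (a n))).
  - apply Series_Rabs, ex_series_dom with b; [|exact Hb].
    intros n; rewrite Rabs_Rabsolu; apply Hab.
  - apply Series_le; [|exact Hb].
    intros n; split; [apply Rabs_pos | apply Hab].
Qed.

Lemma Series_split (a : nat -> R) (N : nat) :
  ex_series a -> Series a = sum_n a N + Series (fun k => a (S N + k)%nat).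
Proof.
  intros Ha; rewrite sum_n_Reals.
  exact (Series_incr_n a (S N) (Nat.lt_0_succ N) Ha).
Qed.

Lemma Rabs_pow_lt1 (q : R) : 0 < q < 1 -> Rabs q < 1.
Proof. intros H; rewrite Rabs_pos_eq; lra. Qed.

Lemma pow_in01 (q : R) (n : nat) : 0 < q < 1 -> 0 < q ^ n <= 1.
Proof.
  intros Hq; split; [apply pow_lt; lra|].
  rewrite <- (pow1 n); apply pow_incr; lra.
Qed.

Lemma lim_pow_mult (q A : R) : 0 < q < 1 -> is_lim_seq (fun n => A * q ^ n) 0.
Proof.
  intros Hq; replace (Finite 0) with (Rbar_mult A 0) by (simpl; f_equal; ring).
  apply is_lim_seq_scal_l, is_lim_seq_geom, Rabs_pow_lt1, Hq.
Qed.

Lemma zero_of_geometric_bound (q A x : R) :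
  0 < q < 1 -> (forall n : nat, Rabs x <= A * q ^ n) -> x = 0.
Proof.
  intros Hq H.
  assert (Rabs x <= 0).
  { apply (is_lim_seq_le (fun _ => Rabs x) (fun n => A * q ^ n) (Rabs x) 0 H).
    - apply is_lim_seq_const.
    - apply lim_pow_mult, Hq. }
  destruct (Req_dec x 0) as [E|E]; [exact E|].
  apply Rabs_pos_lt in E; lra.
Qed.

Lemma Series_sum_n (b : nat -> nat -> R) (N : nat) :
  (forall n, ex_series (fun k => b k n)) ->
  ex_series (fun k => sum_n (b k) N) /\
  Series (fun k => sum_n (b k) N) = sum_n (fun n => Series (fun k => b k n)) N.
Proof.
  intros Hb; induction N as [|N [IHe IHs]].
  - split.
    + apply ex_series_ext with (fun k => b k 0%nat); [|apply Hb].
      intros k; now rewrite sum_O.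
    + rewrite sum_O; apply Series_ext; intros k; now rewrite sum_O.
  - assert (E : forall k, sum_n (b k) N + b k (S N) = sum_n (b k) (S N))
      by (intros k; now rewrite sum_Sn).
    split.
    + apply (ex_series_ext _ _ E).
      exact (ex_series_plus _ _ IHe (Hb (S N))).
    + rewrite <- (Series_ext _ _ E), Series_plus, IHs, sum_Sn;
        [reflexivity | exact IHe | apply Hb].
Qed.

(** Fubini under a product majorant: beyond column [N], row [k] leaves at most [A k] times the tail
    of [B], so the total error is at most [Series A] times that tail. *)
Lemma is_series_exchange (b : nat -> nat -> R) (A B : nat -> R) :
  ex_series A -> ex_series B ->
  (forall k n, Rabs (b k n) <= A k * B n) ->
  is_series (fun n => Series (fun k => b k n))
            (Series (fun k => Series (fun n => b k n))).
Proof.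
  intros HA HB Hb.
  assert (Hrow : forall k, ex_series (fun n => b k n)).
  { intros k; apply ex_series_dom with (fun n => A k * B n); [apply Hb|].
    now apply ex_series_mult_const. }
  assert (Hcol : forall n, ex_series (fun k => b k n)).
  { intros n; apply ex_series_dom with (fun k => B n * A k).
    - intros k; rewrite Rmult_comm; apply Hb.
    - now apply ex_series_mult_const. }
  assert (Hrows : ex_series (fun k => Series (fun n => b k n))).
  { apply ex_series_dom with (fun k => Series B * A k);
      [|now apply ex_series_mult_const].
    intros k; rewrite Rmult_comm, <- Series_scal_l.
    apply Series_dom; [apply Hb | now apply ex_series_mult_const]. }
  set (L := Series (fun k => Series (fun n => b k n))).
  set (F := fun n => Series (fun k => b k n)).
  assert (Htail : forall N,
    Rabs (sum_n F N - L) <= Series A * (Series B - sum_n B N)).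
  { intros N; destruct (Series_sum_n b N Hcol) as [He Hs].
    unfold F, L; rewrite <- Hs, <- Series_minus; [|exact He|exact Hrows].
    rewrite (Series_split B N HB).
    replace (sum_n B N + Series (fun k => B (S N + k)%nat) - sum_n B N)
      with (Series (fun k => B (S N + k)%nat)) by ring.
    rewrite Rmult_comm, <- Series_scal_l.
    assert (HBN : ex_series (fun k => B (S N + k)%nat))
      by (apply (ex_series_incr_n B (S N)); exact HB).
    apply Series_dom; [|now apply ex_series_mult_const].
    intros k; change (Series (fun n => b k n)) with (Series (b k)).
    rewrite (Series_split (b k) N (Hrow k)).
    replace (sum_n (b k) N - (sum_n (b k) N + Series (fun j => b k (S N + j)%nat)))
      with (- Series (fun j => b k (S N + j)%nat)) by ring.
    rewrite Rabs_Ropp, Rmult_comm, <- Series_scal_l.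
    apply Series_dom; [intros j; apply Hb | now apply ex_series_mult_const]. }
  change (is_lim_seq (sum_n F) L).
  assert (Hlim : is_lim_seq (fun N => sum_n F N - L) 0).
  { apply is_lim_seq_abs_0.
    apply is_lim_seq_le_le with (fun _ => 0)
      (fun N => Series A * (Series B - sum_n B N)).
    - intros N; split; [apply Rabs_pos | apply Htail].
    - apply is_lim_seq_const.
    - replace (Finite 0) with (Rbar_mult (Series A) (Series B - Series B))
        by (simpl; f_equal; ring).
      apply is_lim_seq_scal_l.
      apply is_lim_seq_minus'; [apply is_lim_seq_const|].
      exact (Series_correct B HB). }
  apply is_lim_seq_ext with (fun N => (sum_n F N - L) + L); [intros; ring|].
  replace (Finite L) with (Finite (0 + L)) by (f_equal; ring).
  apply is_lim_seq_plus'; [exact Hlim | apply is_lim_seq_const].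
Qed.

(** Since the full sum is zero, a partial sum is minus its tail, which a geometric series
    dominates. *)
Lemma partial_sum_bound (F : nat -> R) (D r : R) (N : nat) :
  0 < r < 1 -> is_series F 0 ->
  (forall i, Rabs (F (S N + i)%nat) <= D * r ^ i) ->
  Rabs (sum_n F N) <= D / (1 - r).
Proof.
  intros Hr HF HD.
  assert (E := Series_split F N (ex_intro _ 0 HF)).
  rewrite (is_series_unique _ _ HF) in E.
  replace (sum_n F N) with (- Series (fun k => F (S N + k)%nat)) by lra.
  rewrite Rabs_Ropp.
  unfold Rdiv; rewrite <- (Series_geom r), <- Series_scal_l by now apply Rabs_pow_lt1.
  apply Series_dom; [exact HD|].
  apply ex_series_mult_const, ex_series_geom, Rabs_pow_lt1, Hr.
Qed.

(** * Bounds on q-shifted factorials *)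

Lemma qpoch_head (a q : R) (n : nat) :
  qpoch a q (S n) = (1 - a) * qpoch (a * q) q n.
Proof.
  induction n as [|n IH]; [simpl; ring|].
  change (qpoch a q (S (S n))) with (qpoch a q (S n) * (1 - a * q ^ S n)).
  rewrite IH; simpl; ring.
Qed.

Lemma qpoch_in01 (a q : R) (n : nat) :
  0 < q < 1 -> 0 <= a < 1 -> 0 < qpoch a q n <= 1.
Proof.
  intros Hq Ha; induction n as [|n IH]; [simpl; lra|].
  simpl; destruct (pow_in01 q n Hq) as [H1 H2].
  assert (0 <= a * q ^ n < 1) by nra.
  nra.
Qed.

(** Weierstrass product inequality: the product is at least 1 minus the geometric sum of the
    [a * q ^ k] with [k < n]. *)
Lemma qpoch_lower_small (a q : R) (n : nat) :
  0 < q < 1 -> 0 <= a -> a <= (1 - q) / 2 -> 1 / 2 <= qpoch a q n.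
Proof.
  intros Hq Ha Haq.
  assert (H : 1 - a * (1 - q ^ n) / (1 - q) <= qpoch a q n).
  { induction n as [|n IH]; [simpl; right; field; lra|].
    destruct (qpoch_in01 a q n Hq ltac:(lra)) as [_ H1].
    destruct (pow_in01 q n Hq) as [H2 _].
    replace (1 - a * (1 - q ^ S n) / (1 - q))
      with (1 - a * (1 - q ^ n) / (1 - q) - a * q ^ n) by (simpl; field; lra).
    simpl; assert (0 <= a * q ^ n) by nra. nra. }
  assert (a * (1 - q ^ n) / (1 - q) <= 1 / 2); [|lra].
  destruct (pow_in01 q n Hq) as [H2 H3].
  apply Rmult_le_reg_r with (1 - q); [lra|].
  unfold Rdiv; rewrite Rmult_assoc, Rinv_l by lra. nra.
Qed.

(** Splitting off the first factor replaces [a] by [a * q]; after finitely many such steps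
    [qpoch_lower_small] applies. *)
Lemma qpoch_lower (a q : R) :
  0 < q < 1 -> 0 <= a < 1 -> exists c, 0 < c /\ forall n, c <= qpoch a q n.
Proof.
  intros Hq Ha.
  assert (HN : exists N, a * q ^ N <= (1 - q) / 2).
  { assert (Hl := lim_pow_mult q a Hq).
    apply is_lim_seq_spec in Hl.
    assert (He : 0 < (1 - q) / 2) by lra.
    destruct (Hl (mkposreal _ He)) as [N HN].
    exists N; specialize (HN N (le_n N)); simpl in HN.
    rewrite Rminus_0_r in HN; apply Rabs_def2 in HN; lra. }
  destruct HN as [N HN].
  revert a Ha HN; induction N as [|N IH]; intros a Ha HN.
  - exists (1 / 2); split; [lra|].
    intros n; apply qpoch_lower_small; simpl in HN; lra.
  - destruct (IH (a * q)) as [c [Hc H]]; [nra|simpl in HN; lra|].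
    exists ((1 - a) * c); split; [nra|].
    intros [|n].
    + specialize (H 0%nat); simpl in *; nra.
    + rewrite qpoch_head; specialize (H n); nra.
Qed.

(** The finite products decrease and stay above a positive constant, so [Lim_seq] is here a genuine
    finite limit. *)
Lemma qpoch_inf_pos (a q : R) :
  0 < q < 1 -> 0 <= a < 1 -> 0 < qpoch_inf a q.
Proof.
  intros Hq Ha.
  destruct (qpoch_lower a q Hq Ha) as [c [Hc H]].
  assert (Hex : ex_finite_lim_seq (qpoch a q)).
  { apply ex_finite_lim_seq_decr with c; [|exact H].
    intros n; destruct (qpoch_in01 a q n Hq Ha).
    destruct (pow_in01 q n Hq); simpl.
    assert (0 <= a * q ^ n) by nra. nra. }
  unfold qpoch_inf; apply Rlt_le_trans with c; [exact Hc|].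
  exact (is_lim_seq_le (fun _ => c) _ c (Finite (real (Lim_seq (qpoch a q)))) H
    (is_lim_seq_const c) (Lim_seq_correct' _ Hex)).
Qed.

(** * Power series with zeros at the points p^-m *)

Lemma triangular_S (n : nat) :
  (S n * (S n + 1) / 2 = n * (n + 1) / 2 + S n)%nat.
Proof.
  replace (S n * (S n + 1))%nat with (n * (n + 1) + S n * 2)%nat by ring.
  apply Nat.div_add; lia.
Qed.

(* On generating functions: [F(z)] becomes [F(z / p) / (1 - z / p)], which
   moves the zero at [p^-(m+1)] to [p^-m]. *)
Definition divide_rescale (p : R) (F : nat -> R) (n : nat) : R :=
  / p ^ n * sum_n F n.

(** Each [is_series] includes convergence at p^-m; for [0 < p < 1] these points are unbounded, so
    the generating function is entire. *)
Definition vanishes_on_grid (p : R) (F : nat -> R) : Prop :=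
  forall m : nat, is_series (fun n => F n * / p ^ (m * n)) 0.

Lemma vanishes_at_one (p : R) (F : nat -> R) :
  vanishes_on_grid p F -> is_series F 0.
Proof.
  intros H; apply is_series_ext with (2 := H 0%nat).
  intros n; simpl; field.
Qed.

(** Partial sums are the coefficients of F(z) / (1 - z). With z = p^-(m+1), the factor [/ p ^ n]
    makes the new value at p^-m equal to F(z) / (1 - z) = 0. *)
Lemma divide_rescale_vanishes (p : R) (F : nat -> R) :
  0 < p < 1 -> vanishes_on_grid p F -> vanishes_on_grid p (divide_rescale p F).
Proof.
  intros Hp HF m.
  assert (Hpow : forall k, 0 < p ^ k) by (intros k; apply pow_lt; lra).
  set (z := / p ^ S m).
  assert (Hz0 : 0 < z) by apply Rinv_0_lt_compat, Hpow.
  assert (Hz : 1 - z <> 0).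
  { assert (p ^ S m < 1) by (apply pow_lt_1_compat; [lra|lia]).
    assert (z * p ^ S m = 1)
      by (unfold z; apply Rinv_l; specialize (Hpow (S m)); lra). nra. }
  assert (Hzn : forall k n, / p ^ (k * n) = (/ p ^ k) ^ n)
    by (intros k n; rewrite pow_mult, pow_inv; reflexivity).
  (* The zero one step further out gives geometric decay of the tails. *)
  set (r := p ^ S (S m)).
  assert (Hr : 0 < r < 1)
    by (split; [apply Hpow | apply pow_lt_1_compat; [lra|lia]]).
  assert (HD : exists D, forall n, Rabs (F n) <= D * r ^ n).
  { assert (Hl := ex_series_lim_0 _ (ex_intro _ 0 (HF (S (S m))))).
    destruct (filterlim_bounded _ (ex_intro _ 0 Hl)) as [D HD].
    exists D; intros n; specialize (HD n).
    change (Rabs (F n * / p ^ (S (S m) * n)) <= D) in HD.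
    rewrite Hzn, Rabs_mult in HD; fold r in HD.
    assert (Hrn : 0 < r ^ n) by (apply pow_lt; lra).
    rewrite pow_inv, Rabs_inv, (Rabs_pos_eq (r ^ n)) in HD by lra.
    apply Rmult_le_reg_r with (/ r ^ n); [now apply Rinv_0_lt_compat|].
    rewrite (Rmult_assoc D), Rinv_r by lra; lra. }
  destruct HD as [D HD].
  set (S_ := sum_n F).
  assert (HS : forall n, Rabs (S_ n) <= D * r ^ S n / (1 - r)).
  { intros n; apply partial_sum_bound; [exact Hr|now apply vanishes_at_one with p|].
    intros i; eapply Rle_trans; [apply HD|].
    rewrite Nat.add_comm, pow_add; right; ring. }
  (* Summation by parts; what remains is that the boundary term [S_ N * z ^ S N] tends to zero. *)
  assert (Habel : forall N, sum_n (fun n => S_ n * z ^ n) N =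
     / (1 - z) * (sum_n (fun n => F n * z ^ n) N - S_ N * z ^ S N)).
  { induction N as [|N IH].
    - unfold S_; rewrite !sum_O; simpl; field; exact Hz.
    - rewrite !sum_Sn, IH.
      assert (E : S_ (S N) = S_ N + F (S N)) by (unfold S_; now rewrite sum_Sn).
      change (@plus R_AbelianMonoid) with Rplus; rewrite E; simpl; field; exact Hz. }
  apply is_series_ext with (fun n => S_ n * z ^ n).
  { intros n; unfold divide_rescale; fold S_.
    rewrite Hzn; unfold z; rewrite <- tech_pow_Rmult, Rinv_mult, Rpow_mult_distr, pow_inv.
    match goal with |- @eq _ ?a ?b => change (@eq R a b) end; ring. }
  change (is_lim_seq (sum_n (fun n => S_ n * z ^ n)) 0).
  apply is_lim_seq_ext with (1 := fun N => eq_sym (Habel N)).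
  replace (Finite 0) with (Rbar_mult (/ (1 - z)) (0 - 0)) by (simpl; f_equal; ring).
  apply is_lim_seq_scal_l, is_lim_seq_minus'.
  - apply is_lim_seq_ext with (2 := HF (S m)).
    intros N; apply sum_n_ext; intros n; rewrite Hzn; reflexivity.
  - apply is_lim_seq_abs_0.
    apply is_lim_seq_le_le with (fun _ => 0) (fun N => D * p / (1 - r) * p ^ N).
    + intros N; split; [apply Rabs_pos|].
      rewrite Rabs_mult, (Rabs_pos_eq (z ^ S N)) by (apply pow_le; lra).
      apply Rle_trans with (D * r ^ S N / (1 - r) * z ^ S N).
      * apply Rmult_le_compat_r; [apply pow_le; lra | apply HS].
      (* The choice of [r] leaves exactly one spare factor [p], so the boundary term is O(p^N). *)
      * right; assert (E : r * z = p).
        { unfold r, z; rewrite <- (tech_pow_Rmult p (S m)); field.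
          specialize (Hpow (S m)); lra. }
        replace (D * r ^ S N / (1 - r) * z ^ S N)
          with (D * (r ^ S N * z ^ S N) / (1 - r)) by (unfold Rdiv; ring).
        rewrite <- Rpow_mult_distr, E; simpl; unfold Rdiv; ring.
    + apply is_lim_seq_const.
    + apply lim_pow_mult, Hp.
Qed.

(** * Weighted coefficient bounds and the vanishing of all coefficients *)

(** The first factor is the size of the Bessel coefficients, the second that of the moments. *)
Definition weight (p : R) (n : nat) : R := p ^ (n * (n + 1) / 2)%nat * p ^ n.

Lemma weight_S (p : R) (n : nat) : weight p (S n) = weight p n * p ^ (n + 2).
Proof. unfold weight; rewrite triangular_S, !pow_add; simpl; ring. Qed.

Lemma weight_pos (p : R) (n : nat) : 0 < p < 1 -> 0 < weight p n.
Proof. intros Hp; apply Rmult_lt_0_compat; apply pow_lt; lra. Qed.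

Lemma weight_tail (p : R) (n i : nat) :
  0 < p < 1 -> weight p (n + i) <= weight p n * (p ^ (n + 2)) ^ i.
Proof.
  intros Hp; induction i as [|i IH].
  - rewrite Nat.add_0_r; simpl; lra.
  - rewrite Nat.add_succ_r, weight_S.
    replace (n + i + 2)%nat with ((n + 2) + i)%nat by lia.
    rewrite pow_add; simpl.
    assert (H1 := weight_pos p (n + i) Hp).
    destruct (pow_in01 p (n + 2) Hp), (pow_in01 p i Hp).
    apply Rle_trans with (weight p (n + i) * p ^ (n + 2)); [|nra].
    apply Rmult_le_compat_l; nra.
Qed.

(** The partial sum is minus a tail starting at [S n], so a bound from [S m] on yields one from [m]
    on. Passing to [weight p (S n)] gains [p ^ (n + 2)], of which the factor [/ p ^ n] leaves
    [p ^ 2]; the geometric denominator is smallest at [n = m]. *)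
Lemma divide_rescale_bound (p C : R) (F : nat -> R) (m : nat) :
  0 < p < 1 -> 0 <= C -> is_series F 0 ->
  (forall n, (S m <= n)%nat -> Rabs (F n) <= C * weight p n) ->
  forall n, (m <= n)%nat ->
  Rabs (divide_rescale p F n) <= C * (p ^ 2 / (1 - p ^ 3 * p ^ m)) * weight p n.
Proof.
  intros Hp HC HF Hb n Hn.
  assert (Hpn := pow_lt p n ltac:(lra)).
  assert (Hr : 0 < p ^ (S n + 2) < 1)
    by (split; [apply pow_lt; lra | apply pow_lt_1_compat; [lra|lia]]).
  assert (HS : Rabs (sum_n F n) <= C * weight p (S n) / (1 - p ^ (S n + 2))).
  { apply partial_sum_bound; [exact Hr|exact HF|].
    intros i; eapply Rle_trans; [apply Hb; lia|].
    rewrite Rmult_assoc; apply Rmult_le_compat_l; [exact HC|].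
    now apply weight_tail. }
  unfold divide_rescale; rewrite Rabs_mult, Rabs_inv, (Rabs_pos_eq (p ^ n)) by lra.
  apply Rle_trans with (/ p ^ n * (C * weight p (S n) / (1 - p ^ (S n + 2)))).
  { apply Rmult_le_compat_l; [left; now apply Rinv_0_lt_compat | exact HS]. }
  rewrite weight_S, pow_add.
  replace (/ p ^ n * (C * (weight p n * (p ^ n * p ^ 2)) / (1 - p ^ (S n + 2))))
    with (C * weight p n * p ^ 2 * / (1 - p ^ (S n + 2))) by (field; lra).
  replace (C * (p ^ 2 / (1 - p ^ 3 * p ^ m)) * weight p n)
    with (C * weight p n * p ^ 2 * / (1 - p ^ 3 * p ^ m)) by (unfold Rdiv; ring).
  apply Rmult_le_compat_l.
  - assert (H := weight_pos p n Hp); assert (0 < p ^ 2) by (apply pow_lt; lra).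
    apply Rmult_le_pos; [|lra]. nra.
  - assert (E : p ^ (S n + 2) <= p ^ 3 * p ^ m).
    { rewrite <- pow_add; replace (S n + 2)%nat with (3 + m + (n - m))%nat by lia.
      rewrite (pow_add p (3 + m)).
      destruct (pow_in01 p (3 + m) Hp), (pow_in01 p (n - m) Hp); nra. }
    assert (p ^ 3 * p ^ m < 1)
      by (rewrite <- pow_add; apply pow_lt_1_compat; [lra|lia]).
    apply Rinv_le_contravar; lra.
Qed.

(** Each division keeps [F 0], lowers by one the index from which the bound holds, and multiplies
    the constant by a factor [p ^ 2 / (1 - p ^ 3 * p ^ j)]. After [m] divisions the bound reaches
    index 0. Both [F] and [C] change, hence are quantified inside the induction. *)
Lemma head_bound (p : R) (m : nat) :
  0 < p < 1 -> forall F C, 0 <= C -> vanishes_on_grid p F ->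
  (forall n, (m <= n)%nat -> Rabs (F n) <= C * weight p n) ->
  Rabs (F 0%nat) <= C * ((p ^ 2) ^ m / qpoch (p ^ 3) p m).
Proof.
  intros Hp.
  assert (Hp3 : 0 < p ^ 3 < 1)
    by (split; [apply pow_lt; lra | apply pow_lt_1_compat; [lra|lia]]).
  induction m as [|m IH]; intros F C HC HF Hb.
  - specialize (Hb 0%nat (le_n 0)); unfold weight in Hb; simpl in Hb.
    eapply Rle_trans; [exact Hb|]. simpl; right; field.
  - assert (E : divide_rescale p F 0%nat = F 0%nat)
      by (unfold divide_rescale; rewrite sum_O; simpl; field).
    assert (H1 : p ^ 3 * p ^ m < 1)
      by (rewrite <- pow_add; apply pow_lt_1_compat; [lra|lia]).
    assert (H2 : 0 < p ^ 2) by (apply pow_lt; lra).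
    rewrite <- E; eapply Rle_trans.
    + apply (IH _ (C * (p ^ 2 / (1 - p ^ 3 * p ^ m)))).
      * apply Rmult_le_pos; [exact HC|]. apply Rlt_le, Rdiv_lt_0_compat; lra.
      * now apply divide_rescale_vanishes.
      * apply divide_rescale_bound; try assumption.
        now apply vanishes_at_one with p.
    + destruct (qpoch_in01 (p ^ 3) p m Hp ltac:(lra)).
      right. change (qpoch (p ^ 3) p (S m)) with (qpoch (p^3) p m * (1 - p ^ 3 * p ^ m)).
      rewrite <- (tech_pow_Rmult (p ^ 2) m). field. split; lra.
Qed.

(** In [head_bound], [(p ^ 2) ^ m] tends to zero while the denominator stays above a positive
    constant. *)
Lemma head_zero (p C : R) (F : nat -> R) :
  0 < p < 1 -> vanishes_on_grid p F ->
  (forall n, Rabs (F n) <= C * weight p n) -> F 0%nat = 0.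
Proof.
  intros Hp HF Hb.
  assert (HC : 0 <= C).
  { specialize (Hb 0%nat); unfold weight in Hb; simpl in Hb.
    pose proof (Rabs_pos (F 0%nat)); lra. }
  destruct (qpoch_lower (p ^ 3) p Hp) as [c [Hc Hq]].
  { split; [apply pow_le; lra | apply pow_lt_1_compat; [lra|lia]]. }
  apply zero_of_geometric_bound with (p ^ 2) (C / c).
  - split; [apply pow_lt; lra | apply pow_lt_1_compat; [lra|lia]].
  - intros m; eapply Rle_trans.
    + apply (head_bound p m Hp F C HC HF); intros n _; apply Hb.
    + unfold Rdiv; rewrite Rmult_assoc; apply Rmult_le_compat_l; [exact HC|].
      rewrite Rmult_comm; apply Rmult_le_compat_r; [apply pow_le, pow_le; lra|].
      apply Rinv_le_contravar; [exact Hc | apply Hq].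
Qed.

(** The shift divides the generating function by z, which at p^-m multiplies the value by
    [p ^ m]. *)
Lemma vanishes_shift (p : R) (F : nat -> R) :
  0 < p < 1 -> F 0%nat = 0 -> vanishes_on_grid p F ->
  vanishes_on_grid p (fun n => F (S n)).
Proof.
  intros Hp H0 HF m.
  assert (Hpm := pow_lt p m ltac:(lra)).
  assert (Hs : is_series (fun n => F (S n) * / p ^ (m * S n)) 0).
  { apply (is_series_incr_1 (fun n => F n * / p ^ (m * n))).
    rewrite H0, Rmult_0_l.
    change (is_series (fun n => F n * / p ^ (m * n)) (0 + 0)).
    rewrite Rplus_0_r; apply HF. }
  apply (is_series_scal_l (p ^ m)) in Hs.
  change (is_series (fun n => p ^ m * (F (S n) * / p ^ (m * S n))) (p ^ m * 0)) in Hs.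
  rewrite Rmult_0_r in Hs.
  apply is_series_ext with (2 := Hs); intros n.
  rewrite Nat.mul_succ_r, pow_add.
  assert (Hpmn := pow_lt p (m * n) ltac:(lra)). simpl. field; lra.
Qed.

(** Induction through F(z) / z; as [weight] decreases, the same [C] serves the shifted sequence. *)
Lemma coefficients_zero (p C : R) (F : nat -> R) :
  0 < p < 1 -> vanishes_on_grid p F ->
  (forall n, Rabs (F n) <= C * weight p n) -> forall n, F n = 0.
Proof.
  intros Hp HF Hb n.
  revert F HF Hb; induction n as [|n IH]; intros F HF Hb.
  - now apply head_zero with p C.
  - apply (IH (fun n => F (S n))).
    + apply vanishes_shift; [exact Hp| |exact HF]. now apply head_zero with p C.
    + intros k; eapply Rle_trans; [apply Hb|].
      rewrite weight_S.
      assert (Hw := weight_pos p k Hp); destruct (pow_in01 p (k + 2) Hp).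
      assert (HC : 0 <= C).
      { specialize (Hb 0%nat); unfold weight in Hb; simpl in Hb.
        pose proof (Rabs_pos (F 0%nat)); lra. }
      apply Rmult_le_compat_l; [exact HC | nra].
Qed.

(** * Uniqueness for the moments *)

(** Once all earlier terms vanish, dividing the [n]-th moment by [p ^ (k * n)] leaves [a k] plus a
    remainder O(p^n), for every [n]. *)
Lemma moments_zero (p : R) (a : nat -> R) :
  0 < p < 1 -> ex_series (fun k => Rabs (a k)) ->
  (forall n, Series (fun k => a k * p ^ (k * n)) = 0) -> forall k, a k = 0.
Proof.
  intros Hp Ha Hm k.
  induction k as [k IH] using (well_founded_induction lt_wf).
  assert (Hak : ex_series (fun j => Rabs (a (S k + j)%nat)))
    by (apply (ex_series_incr_n (fun j => Rabs (a j)) (S k)); exact Ha).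
  apply zero_of_geometric_bound with p (Series (fun j => Rabs (a (S k + j)%nat)));
    [exact Hp|].
  intros n; specialize (Hm n).
  assert (Hex : ex_series (fun j => a (k + j)%nat * p ^ ((k + j) * n))).
  { apply (ex_series_incr_n (fun j => a j * p ^ (j * n)) k).
    apply ex_series_dom with (2 := Ha); intros j.
    destruct (pow_in01 p (j * n) Hp).
    rewrite Rabs_mult, (Rabs_pos_eq (p ^ _)) by lra.
    pose proof (Rabs_pos (a j)); nra. }
  rewrite (Series_incr_n_aux _ k) in Hm
    by (intros j Hj; rewrite (IH j Hj); ring).
  rewrite (Series_incr_1 _ Hex), Nat.add_0_r in Hm.
  assert (Hpkn := pow_lt p (k * n) ltac:(lra)).
  apply Rmult_le_reg_l with (p ^ (k * n)); [exact Hpkn|].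
  replace (p ^ (k * n) * Rabs (a k)) with (Rabs (a k * p ^ (k * n)))
    by (rewrite Rabs_mult, (Rabs_pos_eq (p ^ _)) by lra; ring).
  replace (a k * p ^ (k * n))
    with (- Series (fun j => a (k + S j)%nat * p ^ ((k + S j) * n))) by lra.
  rewrite Rabs_Ropp, (Rmult_comm (Series _)), <- Rmult_assoc, <- Series_scal_l.
  apply Series_dom; [|now apply ex_series_mult_const].
  intros j; replace (k + S j)%nat with (S k + j)%nat by lia.
  (* Every index beyond [k] carries the extra factor [p ^ n], which is the required decay. *)
  replace ((S k + j) * n)%nat with (k * n + n + j * n)%nat by ring.
  rewrite !pow_add, Rabs_mult.
  destruct (pow_in01 p n Hp), (pow_in01 p (j * n) Hp).
  assert (0 < p ^ (k * n) * p ^ n) by now apply Rmult_lt_0_compat.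
  assert (0 < p ^ (k * n) * p ^ n * p ^ (j * n)) by now apply Rmult_lt_0_compat.
  rewrite (Rabs_pos_eq (_ * _)) by lra.
  rewrite Rmult_comm; apply Rmult_le_compat_r; [apply Rabs_pos|].
  rewrite <- (Rmult_1_r (p ^ (k * n) * p ^ n)) at 2.
  apply Rmult_le_compat_l; lra.
Qed.

(** * The normalised Bessel series *)

(** Ratio test: the quotients [p * z * p ^ n] tend to zero. This is the majorant of the Bessel
    series at arbitrarily large arguments. *)
Lemma ex_series_theta (p z : R) :
  0 < p < 1 -> 0 < z -> ex_series (fun n => p ^ (n * (n + 1) / 2)%nat * z ^ n).
Proof.
  intros Hp Hz.
  assert (Hpos : forall n, 0 < p ^ (n * (n + 1) / 2)%nat * z ^ n)
    by (intros n; apply Rmult_lt_0_compat; apply pow_lt; lra).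
  apply ex_series_Rabs, ex_series_DAlembert with 0; [lra| |].
  - intros n; specialize (Hpos n); lra.
  - apply is_lim_seq_ext with (fun n => p * z * p ^ n); [|apply lim_pow_mult, Hp].
    intros n.
    assert (H1 := pow_lt p (n * (n + 1) / 2) ltac:(lra)).
    assert (H2 := pow_lt z n Hz).
    assert (H3 := pow_lt p n ltac:(lra)).
    assert (0 < p * z * p ^ n) by (repeat apply Rmult_lt_0_compat; lra).
    rewrite triangular_S, pow_add.
    rewrite <- (Rabs_pos_eq (p * z * p ^ n)) by lra.
    f_equal; simpl; field; split; apply Rgt_not_eq; assumption.
Qed.

(** The sign is left out to keep this positive. It is applied with [p = q ^ 2] and
    [b = Rpower p (nu + 1)]. *)
Definition bessel_coef (b p : R) (n : nat) : R :=
  p ^ (n * (n + 1) / 2)%nat / (qpoch b p n * qpoch p p n).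

(** The basic hypergeometric series 1phi1(0; b; p, p y): the Bessel function in y = x^2, stripped of
    its constant and of x^nu. *)
Definition bessel_series (b p y : R) : R :=
  Series (fun n => (-1) ^ n * bessel_coef b p n * y ^ n).

Lemma bessel_coef_pos (b p : R) (n : nat) :
  0 < p < 1 -> 0 <= b < 1 -> 0 < bessel_coef b p n.
Proof.
  intros Hp Hb.
  destruct (qpoch_in01 b p n Hp Hb), (qpoch_in01 p p n Hp ltac:(lra)).
  apply Rdiv_lt_0_compat; [apply pow_lt; lra | now apply Rmult_lt_0_compat].
Qed.

Lemma bessel_coef_bound (b p : R) :
  0 < p < 1 -> 0 <= b < 1 ->
  exists D, 0 < D /\ forall n, bessel_coef b p n <= D * p ^ (n * (n + 1) / 2)%nat.
Proof.
  intros Hp Hb.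
  destruct (qpoch_lower b p Hp Hb) as [c1 [Hc1 H1]].
  destruct (qpoch_lower p p Hp ltac:(lra)) as [c2 [Hc2 H2]].
  assert (0 < c1 * c2) by now apply Rmult_lt_0_compat.
  exists (/ (c1 * c2)); split; [now apply Rinv_0_lt_compat|].
  intros n; unfold bessel_coef, Rdiv; rewrite Rmult_comm.
  apply Rmult_le_compat_r; [apply pow_le; lra|].
  apply Rinv_le_contravar; [assumption|].
  specialize (H1 n); specialize (H2 n).
  apply Rmult_le_compat; lra.
Qed.

Lemma Rabs_sign_mult (n : nat) (x y : R) :
  0 <= x -> Rabs ((-1) ^ n * x * y) = x * Rabs y.
Proof.
  intros Hx; rewrite !Rabs_mult, pow_1_abs, (Rabs_pos_eq x Hx); ring.
Qed.

(** Keeps the Bessel series away from zero at small arguments, so that absolute convergence of the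
    transform can be passed to the sequence itself. *)
Lemma bessel_series_near_1 (b p : R) :
  0 < p < 1 -> 0 <= b < 1 ->
  exists A, forall y, 0 <= y <= 1 -> Rabs (bessel_series b p y - 1) <= A * y.
Proof.
  intros Hp Hb.
  destruct (bessel_coef_bound b p Hp Hb) as [D [HD HDn]].
  set (B := fun n => D * (p ^ (n * (n + 1) / 2)%nat * 1 ^ n)).
  assert (HB : ex_series B) by (apply ex_series_mult_const, ex_series_theta; lra).
  assert (HB1 : ex_series (fun n => B (S n))) by (apply (ex_series_incr_1 B), HB).
  exists (Series (fun n => B (S n))); intros y Hy.
  assert (Hbound : forall n, Rabs ((-1) ^ n * bessel_coef b p n * y ^ n) <= B n * y ^ n).
  { intros n; assert (H := bessel_coef_pos b p n Hp Hb).
    assert (H0 := pow_le y n (proj1 Hy)).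
    rewrite Rabs_sign_mult, (Rabs_pos_eq _ H0) by lra.
    apply Rmult_le_compat_r; [exact H0|].
    unfold B; rewrite pow1, Rmult_1_r; apply HDn. }
  assert (HBn : forall n, 0 <= B n)
    by (intros n; unfold B; rewrite pow1, Rmult_1_r;
        apply Rmult_le_pos; [lra | apply pow_le; lra]).
  assert (Hyn : forall n, 0 <= y ^ n <= 1).
  { intros n; split; [apply pow_le; lra|].
    rewrite <- (pow1 n); apply pow_incr; lra. }
  unfold bessel_series; rewrite Series_incr_1.
  - replace ((-1) ^ 0 * bessel_coef b p 0 * y ^ 0) with 1
      by (unfold bessel_coef; simpl; field).
    match goal with |- Rabs (1 + ?s - 1) <= _ => replace (1 + s - 1) with s by ring end.
    rewrite Rmult_comm, <- Series_scal_l.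
    apply Series_dom; [|now apply ex_series_mult_const].
    intros n; eapply Rle_trans; [apply Hbound|].
    specialize (HBn (S n)); destruct (Hyn n).
    simpl pow; rewrite Rmult_comm, Rmult_assoc.
    apply Rmult_le_compat_l; [lra|].
    rewrite <- (Rmult_1_l (B (S n))) at 2.
    apply Rmult_le_compat_r; lra.
  - apply ex_series_dom with B; [|exact HB].
    intros n; eapply Rle_trans; [apply Hbound|].
    rewrite <- (Rmult_1_r (B n)) at 2.
    apply Rmult_le_compat_l; [apply HBn | apply Hyn].
Qed.

(** * Injectivity of the normalised transform *)

Lemma bessel_transform_injective (b p : R) (a : nat -> R) :
  0 < p < 1 -> 0 <= b < 1 -> ex_series (fun k => Rabs (a k)) -> a 0%nat = 0 ->
  (forall m, Series (fun k => a k * bessel_series b p (/ p ^ m * p ^ k)) = 0) ->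
  forall k, a k = 0.
Proof.
  intros Hp Hb Ha Ha0 Hm.
  destruct (bessel_coef_bound b p Hp Hb) as [D [HD HDn]].
  set (mu := fun n => Series (fun k => a k * p ^ (k * n))).
  set (F := fun n => (-1) ^ n * bessel_coef b p n * mu n).
  assert (HF : vanishes_on_grid p F).
  { intros m.
    assert (Hpm := pow_lt p m ltac:(lra)).
    assert (Hz : 0 < / p ^ m) by now apply Rinv_0_lt_compat.
    rewrite <- (Hm m).
    (* Since [p ^ (k * n) <= 1], dropping it from the [n]-th power leaves a product majorant in [k]
       and [n]. *)
    assert (Hex := is_series_exchange
      (fun k n => a k * ((-1) ^ n * bessel_coef b p n * (/ p ^ m * p ^ k) ^ n))
      (fun k => Rabs (a k))
      (fun n => D * (p ^ (n * (n + 1) / 2)%nat * (/ p ^ m) ^ n)) Ha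
      (ex_series_mult_const D _ (ex_series_theta p (/ p ^ m) Hp Hz))).
    assert (Hdom : forall k n,
      Rabs (a k * ((-1) ^ n * bessel_coef b p n * (/ p ^ m * p ^ k) ^ n)) <=
      Rabs (a k) * (D * (p ^ (n * (n + 1) / 2)%nat * (/ p ^ m) ^ n))).
    { intros k n; rewrite Rabs_mult; apply Rmult_le_compat_l; [apply Rabs_pos|].
      assert (H := bessel_coef_pos b p n Hp Hb).
      rewrite Rabs_sign_mult, Rpow_mult_distr, <- pow_mult by lra.
      assert (Hzn := pow_lt _ n Hz); destruct (pow_in01 p (k * n) Hp).
      rewrite Rabs_pos_eq by (apply Rmult_le_pos; lra).
      rewrite <- (Rmult_assoc D); apply Rmult_le_compat; [lra|apply Rmult_le_pos; lra|apply HDn|].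
      rewrite <- (Rmult_1_r ((/ p ^ m) ^ n)) at 2.
      apply Rmult_le_compat_l; lra. }
    specialize (Hex Hdom).
    rewrite (Series_ext _ (fun k => a k * bessel_series b p (/ p ^ m * p ^ k))) in Hex
      by (intros k; apply Series_scal_l).
    apply is_series_ext with (2 := Hex); intros n.
    unfold F, mu.
    replace ((-1) ^ n * bessel_coef b p n * Series (fun k => a k * p ^ (k * n)) * / p ^ (m * n))
      with ((-1) ^ n * bessel_coef b p n * / p ^ (m * n) * Series (fun k => a k * p ^ (k * n)))
      by ring.
    rewrite <- Series_scal_l; apply Series_ext; intros k.
    rewrite Rpow_mult_distr, <- pow_mult, pow_inv, <- pow_mult; ring. }
  assert (HFb : forall n, Rabs (F n) <= D * Series (fun k => Rabs (a k)) * weight p n).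
  { intros n; unfold F.
    assert (H := bessel_coef_pos b p n Hp Hb).
    rewrite Rabs_sign_mult by lra.
    apply Rle_trans with
      (D * p ^ (n * (n + 1) / 2)%nat * (p ^ n * Series (fun k => Rabs (a k))));
      [|unfold weight; right; ring].
    apply Rmult_le_compat; [lra | apply Rabs_pos | apply HDn|].
    rewrite <- Series_scal_l; apply Series_dom; [|now apply ex_series_mult_const].
    (* For [k = 0] there is no factor [p ^ n], and [a 0 = 0] removes the term; all later terms have
       one. *)
    intros [|k].
    - rewrite Ha0, Rmult_0_l, Rabs_R0; lra.
    - simpl Nat.mul; rewrite Rabs_mult, pow_add, Rmult_comm.
      destruct (pow_in01 p n Hp), (pow_in01 p (k * n) Hp).
      apply Rmult_le_compat_r; [apply Rabs_pos|].
      rewrite Rabs_pos_eq by (apply Rmult_le_pos; lra).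
      rewrite <- (Rmult_1_r (p ^ n)) at 2; apply Rmult_le_compat_l; lra. }
  apply moments_zero with p; [exact Hp|exact Ha|].
  intros n; assert (HFn := coefficients_zero p _ F Hp HF HFb n).
  unfold F in HFn.
  assert (H := bessel_coef_pos b p n Hp Hb).
  assert (H1 := pow_nonzero (-1) n ltac:(lra)).
  apply Rmult_integral in HFn as [HFn|HFn]; [|exact HFn].
  apply Rmult_integral in HFn; lra.
Qed.

(** * Reduction of the q-Hankel kernel to the normalised series *)

Lemma Rpower_lt1 (p y : R) : 0 < p < 1 -> 0 < y -> 0 < Rpower p y < 1.
Proof.
  intros Hp Hy; split; [apply exp_pos|].
  assert (Hl : ln p < 0) by (rewrite <- ln_1; apply ln_increasing; lra).
  unfold Rpower; rewrite <- exp_0; apply exp_increasing; nra.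
Qed.

Definition bessel_const (nu p : R) : R :=
  qpoch_inf (Rpower p (nu + 1)) p / qpoch_inf p p.

Lemma bessel_const_pos (nu p : R) : 0 < p < 1 -> -1 < nu -> 0 < bessel_const nu p.
Proof.
  intros Hp Hnu; assert (H := Rpower_lt1 p (nu + 1) Hp ltac:(lra)).
  apply Rdiv_lt_0_compat; apply qpoch_inf_pos; lra.
Qed.

Lemma qBessel_eq (nu p y : R) : 0 < y ->
  qBessel nu y p =
  bessel_const nu p * Rpower y nu * bessel_series (Rpower p (nu + 1)) p (y ^ 2).
Proof.
  intros Hy; unfold qBessel, bessel_series; fold (bessel_const nu p).
  rewrite Rmult_assoc; f_equal; rewrite <- Series_scal_l.
  apply Series_ext; intros n.
  replace (2 * INR n) with (INR (2 * n)) by (rewrite mult_INR; reflexivity).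
  rewrite (Rpower_plus (INR (2 * n))), Rpower_pow, pow_mult by exact Hy.
  unfold bessel_coef; ring.
Qed.

(** Here [g k] stands for the real or imaginary part of [f] at [q ^ k]; the summability hypothesis
    is the convergence at x = 1. *)
Lemma real_hankel_injective (q nu : R) (g : nat -> R) :
  0 < q < 1 -> -1 < nu -> g 0%nat = 0 ->
  ex_series (fun k =>
    Rabs (sqrt (q ^ k) * qBessel nu (q ^ k) (q ^ 2) * g k * q ^ k)) ->
  (forall m, Series (fun k =>
    sqrt (/ q ^ m * q ^ k) * qBessel nu (/ q ^ m * q ^ k) (q ^ 2) * g k * q ^ k) = 0) ->
  forall k, g k = 0.
Proof.
  intros Hq Hnu Hg0 Hex HH.
  set (p := q ^ 2) in *.
  assert (Hp : 0 < p < 1)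
    by (split; [apply pow_lt; lra | apply pow_lt_1_compat; [lra|lia]]).
  set (b := Rpower p (nu + 1)).
  assert (Hb : 0 <= b < 1) by (assert (H := Rpower_lt1 p (nu + 1) Hp); unfold b; lra).
  assert (HK := bessel_const_pos nu p Hp Hnu).
  set (K := bessel_const nu p) in *.
  assert (Hqk : forall k, 0 < q ^ k) by (intros; apply pow_lt; lra).
  (* The kernel factors: [h] takes the positive part depending on [k], including the weight of the
     q-integral. *)
  set (h := fun k => sqrt (q ^ k) * Rpower (q ^ k) nu * q ^ k).
  assert (Hh : forall k, 0 < h k).
  { intros k; unfold h; apply Rmult_lt_0_compat; [|apply Hqk].
    apply Rmult_lt_0_compat; [apply sqrt_lt_R0, Hqk | apply exp_pos]. }
  set (a := fun k => h k * g k).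
  assert (Hsq : forall k, (q ^ k) ^ 2 = p ^ k)
    by (intros k; unfold p; rewrite <- !pow_mult, Nat.mul_comm; reflexivity).
  assert (Ha : ex_series (fun k => Rabs (a k))).
  (* The summands at x = 1 are [K * (a k * G)] with [G] at least 1/2 for large [k], which gives the
     majorant with constant [2 / K]. *)
  { destruct (bessel_series_near_1 b p Hp Hb) as [A HA].
    assert (HM : exists M, forall k, (M <= k)%nat -> A * p ^ k <= 1 / 2).
    { assert (Hl := lim_pow_mult p A Hp); apply is_lim_seq_spec in Hl.
      destruct (Hl (mkposreal (1 / 2) ltac:(lra))) as [M HM].
      exists M; intros k Hk; specialize (HM k Hk); simpl in HM.
      rewrite Rminus_0_r in HM; apply Rabs_def2 in HM; lra. }
    destruct HM as [M HM].
    apply (ex_series_incr_n (fun k => Rabs (a k)) M).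
    apply (ex_series_incr_n _ M) in Hex.
    apply ex_series_dom with (2 := ex_series_mult_const (2 / K) _ Hex).
    intros j; set (k := (M + j)%nat).
    rewrite Rabs_Rabsolu, qBessel_eq, Hsq by apply Hqk; fold K b.
    specialize (HM k ltac:(unfold k; lia)).
    destruct (pow_in01 p k Hp).
    specialize (HA (p ^ k) ltac:(lra)).
    set (G := bessel_series b p (p ^ k)) in *.
    assert (HG : 1 / 2 <= Rabs G).
    { eapply Rle_trans; [|apply Rle_abs].
      apply Rabs_le_between in HA; lra. }
    replace (sqrt (q ^ k) * (K * Rpower (q ^ k) nu * G) * g k * q ^ k)
      with (K * (a k * G)) by (unfold a, h; ring).
    rewrite Rabs_mult, (Rabs_pos_eq K), Rabs_mult by lra.
    replace (2 / K * (K * (Rabs (a k) * Rabs G))) with (2 * Rabs (a k) * Rabs G)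
      by (field; lra).
    pose proof (Rabs_pos (a k)); nra. }
  assert (Hak : forall k, a k = 0).
  { apply bessel_transform_injective with b p; try assumption.
    - unfold a; rewrite Hg0; ring.
    - intros m; specialize (HH m).
      assert (Hz : 0 < / q ^ m) by apply Rinv_0_lt_compat, Hqk.
      (* All factors independent of [k]; being positive, [c] cancels from the equation. *)
      set (c := K * sqrt (/ q ^ m) * Rpower (/ q ^ m) nu).
      assert (Hc : 0 < c).
      { unfold c; apply Rmult_lt_0_compat; [|apply exp_pos].
        apply Rmult_lt_0_compat; [exact HK | now apply sqrt_lt_R0]. }
      rewrite (Series_ext _ (fun k => c * (a k * bessel_series b p (/ p ^ m * p ^ k)))) in HH.
      + rewrite Series_scal_l in HH; apply Rmult_integral in HH; lra.
      + intros k; specialize (Hqk k).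
        rewrite qBessel_eq by now apply Rmult_lt_0_compat.
        rewrite sqrt_mult, <- Rpower_mult_distr, Rpow_mult_distr, pow_inv, !Hsq by lra.
        unfold c, a, h; fold K b; ring. }
  intros k; specialize (Hak k); specialize (Hh k).
  unfold a in Hak; apply Rmult_integral in Hak; lra.
Qed.

(** * The complex transform through its real and imaginary parts *)

Theorem theorem3 (q nu : R) (f : R -> C)
  (hq : 0 < q < 1)
  (hnu : -1 < nu)
  (hf : Lq1 q f)
  (hconv : forall n : nat,
     Lq1 q (qHankel_integrand q nu f (powerRZ q (- Z.of_nat n))))
  (hf0 : forall n : nat, f (powerRZ q (- Z.of_nat n)) = RtoC 0)
  (hH0 : forall n : nat, qHankel q nu f (powerRZ q (- Z.of_nat n)) = RtoC 0) :
  forall k : Z, f (powerRZ q k) = RtoC 0.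
Proof.
  assert (Hneg : forall n : nat, powerRZ q (- Z.of_nat n) = / q ^ n)
    by (intros n; rewrite powerRZ_neg', <- pow_powerRZ; reflexivity).
  (* [P] will be [Re] or [Im]; both commute with the real kernel and are bounded by the modulus. *)
  assert (Hproj : forall P : C -> R,
    (forall c, Rabs (P c) <= Cmod c) ->
    (forall r c, P (RtoC r * c)%C = r * P c) ->
    (forall n : nat, qintR q (fun t =>
       P (qHankel_integrand q nu f (powerRZ q (- Z.of_nat n)) t)) = 0) ->
    forall k : nat, P (f (q ^ k)) = 0).
  { intros P HP1 HP2 HP3.
    assert (HP0 : P (RtoC 0) = 0).
    { rewrite <- (Cmult_0_l 0), HP2; ring. }
    apply (real_hankel_injective q nu); try assumption.
    - specialize (hf0 0%nat); simpl in hf0; simpl; now rewrite hf0.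
    - destruct (hconv 0%nat) as [H _].
      apply ex_series_dom with (2 := H); intros k.
      rewrite Rabs_Rabsolu, <- pow_powerRZ, Hneg; simpl pow at 3.
      unfold qHankel_integrand.
      replace (/ q ^ 0 * q ^ k) with (q ^ k) by (simpl; field).
      rewrite Rabs_mult, (Rabs_pos_eq (q ^ k)) by (apply pow_le; lra).
      apply Rmult_le_compat_r; [apply pow_le; lra|].
      rewrite <- HP2; apply HP1.
    - intros m; specialize (HP3 m); unfold qintR, zSeries in HP3.
      (* The half over negative exponents vanishes with [f]; the form [0 * 0] lets [Series_scal_l]
         extract the factor zero. *)
      rewrite (Series_ext (fun n => P (qHankel_integrand _ _ _ _ (powerRZ q (- Z.of_nat (S n))))
        * powerRZ q (- Z.of_nat (S n))) (fun _ => 0 * 0)), Series_scal_l in HP3.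
      2:{ intros n; unfold qHankel_integrand; rewrite HP2, hf0, HP0; ring. }
      apply Rmult_integral in HP3 as [HP3|HP3]; [lra|].
      rewrite Rmult_0_l, Rplus_0_r in HP3.
      rewrite <- HP3; apply Series_ext; intros k.
      unfold qHankel_integrand; rewrite HP2, Hneg, <- pow_powerRZ; reflexivity. }
  assert (Hpos : forall k : nat, f (q ^ k) = RtoC 0).
  { intros k; apply injective_projections; simpl.
    - apply (Hproj Re).
      + exact re_le_Cmod.
      + intros r [x y]; simpl; ring.
      + intros n; exact (f_equal fst (hH0 n)).
    - apply (Hproj Im).
      + intros c; eapply Rle_trans; [apply Rmax_r | apply Rmax_Cmod].
      + intros r [x y]; simpl; ring.
      + intros n; exact (f_equal snd (hH0 n)). }
  intros k; destruct (Z.le_gt_cases 0 k) as [Hk|Hk].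
  - rewrite <- (Z2Nat.id k Hk), <- pow_powerRZ; apply Hpos.
  - replace k with (- Z.of_nat (Z.to_nat (- k)))%Z by lia; apply hf0.
Qed.
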